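(* Let $x=(x_1,\dots,x_T)$ be a path with $P^{\mathrm{obs}}(X=x)>0$ and suppose $P^{\mathrm{obs}}(Y=y^j\mid X=x)=p_j>0$, $j=1,\dots,J$, with $y^1,\dots,y^J\in\mathbb R^T$ distinct and $\sum_jp_j=1$. Let $\theta=(b_0,b_1,r)$ with $r>0$. Then the joint-quantile primal LP for path $x$ and candidate $\theta$ (defined in the context) is feasible if and only if $$\Psi_{x,\theta}^{\mathrm{fin}}(\lambda):=\sum_{j=1}^Jp_j\max_{1\le p\le P}s_{jp}(\theta;\lambda)\ \ge0\qquad\text{for every }\lambda=(\lambda_{\ell pt}^-,\lambda_{\ell pt}^+)_{\ell\in\{0,1\},p\le P,t\le T}\ge0 .$$ If the primal LP is infeasible, some nonnegative $\lambda$ makes $\Psi_{x,\theta}^{\mathrm{fin}}(\lambda)<0$.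
   Context: $T,k\ge1$ are integers, $\tau\in(0,1)$, $\tau\ne1/2$, quantile constants $q_0=1/2$, $q_1=\tau$. $P^{\mathrm{obs}}$ is the law of $(Y,X)$, $Y\in\mathbb R^T$, $X=(X_1,\dots,X_T)$, $X_t\in\mathbb R^k$; $b_0,b_1\in\mathbb R^k$. Put $z_{j0t}(\theta)=y_t^j-x_t'b_0$, $z_{j1t}(\theta)=(y_t^j-x_t'b_1)/r$, and let $v_1<\dots<v_P$ be the distinct values among the numbers $z_{j\ell t}(\theta)$ ($j\le J$, $\ell=0,1$, $t\le T$). Primal LP: find $(q_{jp})_{j\le J,p\le P}$ with $q_{jp}\ge0$; $\sum_pq_{jp}=p_j$ for all $j$; and, for all $\ell\in\{0,1\}$, $t\le T$, $p\le P$, $\sum_jq_{jp}\{\mathbf 1(z_{j\ell t}(\theta)\le v_p)-q_\ell\}\ge0$ and $\sum_jq_{jp}\{q_\ell-\mathbf 1(z_{j\ell t}(\theta)<v_p)\}\ge0$. Score: $$s_{jp}(\theta;\lambda)=\sum_{\ell=0}^1\sum_{t=1}^T\Big[\lambda_{\ell pt}^-\{\mathbf 1(z_{j\ell t}(\theta)\le v_p)-q_\ell\}+\lambda_{\ell pt}^+\{q_\ell-\mathbf 1(z_{j\ell t}(\theta)<v_p)\}\Big].$$ *)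

(* Defs.v *)
From HB Require Import structures.
From mathcomp Require Import all_boot all_order all_algebra.
From mathcomp Require Import all_classical all_reals all_analysis.
Set Implicit Arguments.
Unset Strict Implicit.
Unset Printing Implicit Defensive.
Import Order.TTheory GRing.Theory Num.Theory.
Local Open Scope classical_set_scope.
Local Open Scope ring_scope.

(* R^n is the product measurable space [n.-tuple R]. *)
Definition outcome (R : realType) (T : nat) := T.-tuple (measurableTypeR R).
Definition covpath (R : realType) (T k : nat) :=
  T.-tuple (k.-tuple (measurableTypeR R)).

(* Only meaningful when P B is nonzero. *)
Definition cond_prob (R : realType) (d : measure_display)
    (U : measurableType d) (P : probability U R) (A B : set U) : R :=
  fine (P (A `&` B)) / fine (P B).

Record param (R : realType) (k : nat) :=
  Param { b0 : k.-tuple R ; b1 : k.-tuple R ; r : R }.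

Definition dot (R : realType) (k : nat) (u v : k.-tuple R) : R :=
  \sum_(i < k) tnth u i * tnth v i.

Definition qlevel (R : realType) (tau : R) (l : 'I_2) : R :=
  if l == ord0 then 2^-1 else tau.

Definition zval (R : realType) (T k J : nat) (y : 'I_J -> outcome R T)
    (x : covpath R T k) (theta : param R k)
    (j : 'I_J) (l : 'I_2) (t : 'I_T) : R :=
  if l == ord0 then tnth (y j) t - dot (tnth x t) (b0 theta)
  else (tnth (y j) t - dot (tnth x t) (b1 theta)) / r theta.

Definition grid (R : realType) (T k J : nat) (y : 'I_J -> outcome R T)
    (x : covpath R T k) (theta : param R k) : seq R :=
  sort <=%R (undup [seq zval y x theta i.1.1 i.1.2 i.2 | i : 'I_J * 'I_2 * 'I_T]).

Definition gridsize (R : realType) (T k J : nat) (y : 'I_J -> outcome R T)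
    (x : covpath R T k) (theta : param R k) : nat :=
  size (grid y x theta).

Definition gridpt (R : realType) (T k J : nat) (y : 'I_J -> outcome R T)
    (x : covpath R T k) (theta : param R k) (p : 'I_(gridsize y x theta)) : R :=
  nth 0 (grid y x theta) p.

Definition slack_minus (R : realType) (T k J : nat) (tau : R)
    (y : 'I_J -> outcome R T) (x : covpath R T k) (theta : param R k)
    (j : 'I_J) (l : 'I_2) (p : 'I_(gridsize y x theta)) (t : 'I_T) : R :=
  (zval y x theta j l t <= gridpt p)%R%:R - qlevel tau l.

Definition slack_plus (R : realType) (T k J : nat) (tau : R)
    (y : 'I_J -> outcome R T) (x : covpath R T k) (theta : param R k)
    (j : 'I_J) (l : 'I_2) (p : 'I_(gridsize y x theta)) (t : 'I_T) : R :=
  qlevel tau l - (zval y x theta j l t < gridpt p)%R%:R.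

Definition primal_feasible (R : realType) (T k J : nat) (tau : R)
    (y : 'I_J -> outcome R T) (prob : 'I_J -> R)
    (x : covpath R T k) (theta : param R k) : Prop :=
  exists q : 'I_J -> 'I_(gridsize y x theta) -> R,
    [/\ forall j p, 0 <= q j p,
        forall j, \sum_p q j p = prob j,
        forall l t p, 0 <= \sum_j q j p * slack_minus tau j l p t
      & forall l t p, 0 <= \sum_j q j p * slack_plus tau j l p t].

Definition score (R : realType) (T k J : nat) (tau : R)
    (y : 'I_J -> outcome R T) (x : covpath R T k) (theta : param R k)
    (lm lp : 'I_2 -> 'I_(gridsize y x theta) -> 'I_T -> R)
    (j : 'I_J) (p : 'I_(gridsize y x theta)) : R :=
  \sum_(l < 2) \sum_(t < T)
    (lm l p t * slack_minus tau j l p t + lp l p t * slack_plus tau j l p t).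

(* The initial value is a member of the family, so for n > 0 this is its
   genuine maximum, also when all its members are negative. *)
Definition max_ord (R : realType) (n : nat) (f : 'I_n -> R) : R :=
  \big[Num.max/head 0 [seq f p | p : 'I_n]]_(p < n) f p.

Definition Psi_fin (R : realType) (T k J : nat) (tau : R)
    (y : 'I_J -> outcome R T) (prob : 'I_J -> R)
    (x : covpath R T k) (theta : param R k)
    (lm lp : 'I_2 -> 'I_(gridsize y x theta) -> 'I_T -> R) : R :=
  \sum_(j < J) prob j * max_ord (score tau lm lp j).

Arguments primal_feasible {R T k J} tau y prob x theta.
Arguments Psi_fin {R T k J} tau y prob x theta lm lp.

(* Main.v *)
(** The score inequality is the Farkas certificate of infeasibility of the
    primal LP.  If no [q] exists, Farkas' lemma gives [lambda >= 0] and reals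
    [alpha j] with [alpha j + s_jp <= 0] for all [j, p] and
    [sum_j p_j * alpha j > 0]; hence [max_p s_jp <= - alpha j], and the
    [p]-average of these maxima is negative.  Farkas' lemma itself is obtained
    by Fourier-Motzkin elimination, one variable at a time. *)

Require Import Defs.
From HB Require Import structures.
From mathcomp Require Import all_boot all_order all_algebra.
From mathcomp Require Import all_classical all_reals all_analysis.
From mathcomp Require Import ring lra.
Import Order.TTheory GRing.Theory Num.Theory.
Local Open Scope classical_set_scope.
Local Open Scope ring_scope.

(** * Fourier-Motzkin elimination and Farkas' lemma *)

(** Rows with [a i > 0] bound [t] above by [g i / a i], rows with [a i < 0] bound it below, and the
    second hypothesis puts every lower bound under every upper bound. The largest lower bound is a
    solution; without lower bounds, the smallest upper bound is. *)
Lemma one_variable_system (F : realFieldType) (I : finType) (a g : I -> F) :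
  (forall i, a i = 0 -> 0 <= g i) ->
  (forall i k, 0 < a i -> a k < 0 -> 0 <= a i * g k - a k * g i) ->
  exists t, forall i, a i * t <= g i.
Proof.
move=> g0 gpn.
have [k0 ak0|noneg] := pickP (fun k => a k < 0).
  exists (g [arg max_(k > k0 | a k < 0) (g k / a k)]%O /
          a [arg max_(k > k0 | a k < 0) (g k / a k)]%O).
  case: arg_maxP => // k ak kmax i.
  case: (ltrgtP (a i) 0) => [ai|ai|ai]; last by rewrite ai mul0r g0.
    by rewrite mulrC -ler_ndivrMr //; exact: kmax.
  rewrite mulrA ler_ndivrMr //.
  by have := gpn i k ai ak; rewrite subr_ge0 mulrC (mulrC (g i)).
have [k0 ak0|nopos] := pickP (fun k => 0 < a k).
  exists (g [arg min_(k < k0 | 0 < a k) (g k / a k)]%O /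
          a [arg min_(k < k0 | 0 < a k) (g k / a k)]%O).
  case: arg_minP => // k ak kmin i.
  case: (ltrgtP (a i) 0) => [ai|ai|ai]; last by rewrite ai mul0r g0.
    by have := noneg i; rewrite ai.
  by rewrite mulrC -ler_pdivlMr //; exact: kmin.
exists 0 => i; rewrite mulr0.
case: (ltrgtP (a i) 0) => [ai|ai|ai]; last exact: g0.
  by have := noneg i; rewrite ai.
by have := nopos i; rewrite ai.
Qed.

Lemma sum_prod (F : nmodType) (I K : finType) (f : I * K -> F) :
  \sum_c f c = \sum_i \sum_k f (i, k).
Proof. by rewrite pair_bigA; apply: eq_bigr => -[]. Qed.

(* The nonnegative row combinations of Fourier-Motzkin elimination: the rows
   not involving the eliminated variable, and for each pair of rows with
   coefficients of opposite signs the combination cancelling the variable. *)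
Definition fm_coef (F : realFieldType) (I : finType) (a : I -> F)
    (c : I + I * I) (i : I) : F :=
  match c with
  | inl k => (a k == 0)%:R * (i == k)%:R
  | inr (h, k) => ((0 < a h) && (a k < 0))%:R *
                  (a h * (i == k)%:R - a k * (i == h)%:R)
  end.

Lemma sum_delta (F : realFieldType) (I : finType) (k : I) (f : I -> F) :
  \sum_i (i == k)%:R * f i = f k.
Proof.
rewrite (bigD1 k) //= eqxx mul1r big1 ?addr0 // => i /negbTE ->.
by rewrite mul0r.
Qed.

Lemma fm_coef_sum (F : realFieldType) (I : finType) (a f : I -> F) c :
  \sum_i fm_coef F I a c i * f i =
  match c with
  | inl k => (a k == 0)%:R * f k
  | inr (h, k) => ((0 < a h) && (a k < 0))%:R * (a h * f k - a k * f h)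
  end.
Proof.
case: c => [k|[h k]] /=.
  by rewrite -(sum_delta F I k f) mulr_sumr; apply: eq_bigr => i _; rewrite mulrA.
rewrite -(sum_delta F I k f) -(sum_delta F I h f) !mulr_sumr -sumrB mulr_sumr.
by apply: eq_bigr => i _; ring.
Qed.

Lemma fm_coef_ge0 (F : realFieldType) (I : finType) (a : I -> F) c i :
  0 <= fm_coef F I a c i.
Proof.
case: c => [k|[h k]] /=; first by rewrite mulr_ge0 ?ler0n.
case: andP => [[ah ak]|_]; last by rewrite mul0r.
by rewrite mul1r subr_ge0 (@le_trans _ _ 0) ?mulr_le0_ge0 ?mulr_ge0 ?ler0n ?ltW.
Qed.

(** Induction on the list [s] of variables that may still occur: eliminating one empties its column
    but keeps the type [V]. The row type [I] grows to [I + I * I], so it is generalized in the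
    induction. *)
Lemma farkas_supported (F : realFieldType) (V : finType) (s : seq V)
    (I : finType) (A : I -> V -> F) (b : I -> F) :
  (forall i v, v \notin s -> A i v = 0) ->
  (exists x : V -> F, forall i, \sum_v A i v * x v <= b i) \/
  (exists z : I -> F, [/\ forall i, 0 <= z i,
     forall v, \sum_i z i * A i v = 0 & \sum_i z i * b i < 0]).
Proof.
elim: s I A b => [|v s IH] I A b supp.
  (* With no variable left, the rows read [0 <= b i], and a row violating this is itself the
     certificate. *)
  have [k bk|bge0] := pickP (fun k => b k < 0).
    right; exists (fun i => (i == k)%:R); split; first by move=> i; exact: ler0n.
      by move=> v; rewrite sum_delta supp.
    by rewrite sum_delta.
  left; exists (fun=> 0) => i; rewrite big1 => [|w _]; last by rewrite mulr0.
  by have /negbT := bge0 i; rewrite -leNgt.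
pose a i := A i v; pose C := fm_coef F I a.
have Cv c : \sum_i C c i * a i = 0.
  rewrite fm_coef_sum; case: c => [k|[h k]]; last by rewrite mulrC (mulrC (a h)) subrr mul0r.
  by case: eqP => [->|_]; rewrite ?mulr0 ?mul0r.
have suppC c w : w \notin s -> \sum_i C c i * A i w = 0.
  move=> ws; have [->|wv] := eqVneq w v; first exact: Cv.
  by rewrite big1 // => i _; rewrite supp ?mulr0 // inE negb_or wv.
have [[x Cx]|[z [z0 zA zb]]] := IH _ _ (fun c => \sum_i C c i * b i) suppC.
(* The residual [g] already subtracts the contribution of [x v], so the [t] found below is an
   increment of [x v], not its new value. *)
- pose g i := b i - \sum_w A i w * x w.
  have Cg c : 0 <= \sum_i C c i * g i.
    have := Cx c; rewrite -subr_ge0; congr (0 <= _).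
    under [in RHS]eq_bigr do rewrite mulrBr mulr_sumr.
    rewrite sumrB; congr (_ - _); rewrite exchange_big /=.
    by apply: eq_bigr => w _; rewrite mulr_suml; apply: eq_bigr => i _; rewrite mulrA.
  have [||t at_le] := @one_variable_system F I a g.
  + by move=> i ai; have := Cg (inl i); rewrite fm_coef_sum ai eqxx mul1r.
  + by move=> h k ah ak; have := Cg (inr (h, k)); rewrite fm_coef_sum ah ak mul1r.
  left; exists (fun w => x w + (w == v)%:R * t) => i.
  have := at_le i; rewrite /g lerBrDr; congr (_ <= _).
  under [in RHS]eq_bigr do rewrite mulrDr mulrCA.
  by rewrite big_split /= sum_delta addrC.
(* A certificate for the combined rows pulls back to the original rows through the nonnegative
   coefficients [C]. *)
- right; exists (fun i => \sum_c z c * C c i).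
  have push f : \sum_i (\sum_c z c * C c i) * f i = \sum_c z c * \sum_i C c i * f i.
    under eq_bigr do rewrite mulr_suml.
    rewrite exchange_big /=; apply: eq_bigr => c _; rewrite mulr_sumr.
    by apply: eq_bigr => i _; rewrite mulrA.
  split=> [i|w|]; last by rewrite push.
    by apply: sumr_ge0 => c _; rewrite mulr_ge0 ?fm_coef_ge0.
  by rewrite push.
Qed.

(** Sign constraints become rows and each equation two opposite inequalities. The multipliers of the
    sign rows are the slack in the dual inequality, and those of the two halves of an equation
    combine into [al e], which has no sign constraint. *)
Lemma farkas_mixed (F : realFieldType) (V E I : finType)
    (B : E -> V -> F) (d : E -> F) (A : I -> V -> F) :
  (exists x : V -> F, [/\ forall v, 0 <= x v,
     forall e, \sum_v B e v * x v = d e & forall i, 0 <= \sum_v A i v * x v]) \/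
  (exists (al : E -> F) (lam : I -> F), [/\ forall i, 0 <= lam i,
     forall v, \sum_e al e * B e v + \sum_i lam i * A i v <= 0
     & 0 < \sum_e al e * d e]).
Proof.
pose M (c : (V + I) + (E + E)) v := match c with
  | inl (inl w) => - (v == w)%:R | inl (inr i) => - A i v
  | inr (inl e) => B e v | inr (inr e) => - B e v end.
pose m (c : (V + I) + (E + E)) := match c with
  | inl _ => 0 | inr (inl e) => d e | inr (inr e) => - d e end.
have suppM c v : v \notin enum V -> M c v = 0 by rewrite mem_enum.
have [[x Mx]|[z [z0 zM zm]]] := farkas_supported F V _ _ M m suppM.
- have opp f : \sum_v - f v * x v = - \sum_v f v * x v.
    by rewrite -sumrN; apply: eq_bigr => v _; rewrite mulNr.
  left; exists x; split=> [v|e|i].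
  + by have := Mx (inl (inl v)); rewrite /= opp sum_delta oppr_le0.
  + apply/eqP; rewrite eq_le (Mx (inr (inl e))) /=.
    by have := Mx (inr (inr e)); rewrite /= opp lerN2.
  + by have := Mx (inl (inr i)); rewrite /= opp oppr_le0.
- right; exists (fun e => z (inr (inr e)) - z (inr (inl e))).
  exists (fun i => z (inl (inr i))); split=> [//|v|].
  + have := zM v; rewrite !big_sumType /=.
    have -> : \sum_w z (inl (inl w)) * - (v == w)%:R = - z (inl (inl v)).
      rewrite -(sum_delta F V v (fun w => z (inl (inl w)))) -sumrN.
      by apply: eq_bigr => w _; rewrite eq_sym mulrN mulrC.
    under [X in _ + X + _ = _]eq_bigr do rewrite mulrN.
    under [X in _ + (_ + X) = _]eq_bigr do rewrite mulrN.
    under [X in X + _ <= _]eq_bigr do rewrite mulrBl.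
    rewrite !sumrN sumrB; have := z0 (inl (inl v)); lra.
  + move: zm; rewrite !big_sumType /=.
    under eq_bigr do rewrite mulr0.
    under [X in _ + X + _ < _]eq_bigr do rewrite mulr0.
    under [X in _ + (_ + X) < _]eq_bigr do rewrite mulrN.
    under [X in _ -> 0 < X]eq_bigr do rewrite mulrBl.
    rewrite !big1_eq sumrN sumrB; lra.
Qed.

(** * Maxima over a nonempty grid *)

Lemma le_max_ord (R : realType) (n : nat) (f : 'I_n -> R) p : f p <= max_ord f.
Proof. exact: le_bigmax. Qed.

Lemma max_ord_le (R : realType) (n : nat) (f : 'I_n -> R) (c : R) :
  (0 < n)%N -> (forall p, f p <= c) -> max_ord f <= c.
Proof.
move=> n_gt0 fc; apply: bigmax_le => //.
(* The initial value of the iterated maximum must be bounded as well; for [0 < n] it is a value of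
   [f]. *)
case E: [seq f p | p : 'I_n] => [|a s] /=.
  by move/eqP: E; rewrite -size_eq0 size_map -cardT card_ord -leqn0 leqNgt n_gt0.
have /codomP[p ->] : a \in codom f by rewrite [codom f]E mem_head.
exact: fc.
Qed.

Lemma gridsize_gt0 (R : realType) (T k J : nat) (y : 'I_J -> outcome R T)
    (x : covpath R T k) (theta : param R k) :
  (0 < T)%N -> (0 < J)%N -> (0 < gridsize y x theta)%N.
Proof.
case: T y x => // T y x _; case: J y => // J y _.
rewrite /gridsize /grid size_sort -has_predT.
apply/hasP; exists (zval y x theta ord0 ord0 ord0) => //.
by rewrite mem_undup; apply/mapP; exists (ord0, ord0, ord0); rewrite ?mem_enum.
Qed.

(** * Weak and strong duality for the primal LP *)

Lemma sum_score (R : realType) (T k J : nat) (tau : R)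
    (y : 'I_J -> outcome R T) (x : covpath R T k) (theta : param R k)
    (q : 'I_J -> 'I_(gridsize y x theta) -> R)
    (lm lp : 'I_2 -> 'I_(gridsize y x theta) -> 'I_T -> R) :
  \sum_j \sum_p q j p * score tau lm lp j p =
  \sum_p \sum_l \sum_t
    (lm l p t * (\sum_j q j p * slack_minus tau j l p t) +
     lp l p t * (\sum_j q j p * slack_plus tau j l p t)).
Proof.
rewrite exchange_big /=; apply: eq_bigr => p _.
under eq_bigr do rewrite mulr_sumr.
rewrite exchange_big /=; apply: eq_bigr => l _.
under eq_bigr do rewrite mulr_sumr.
rewrite exchange_big /=; apply: eq_bigr => t _.
by rewrite !mulr_sumr -big_split /=; apply: eq_bigr => j _; ring.
Qed.

(** Weak duality: the [q]-weighted score is a nonnegative combination of the primal constraints, and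
    since row [j] of [q] has mass [prob j], it is at most [Psi_fin]. *)
Lemma feasible_Psi_ge0 (R : realType) (T k J : nat) (tau : R)
    (y : 'I_J -> outcome R T) (prob : 'I_J -> R)
    (x : covpath R T k) (theta : param R k)
    (lm lp : 'I_2 -> 'I_(gridsize y x theta) -> 'I_T -> R) :
  primal_feasible tau y prob x theta ->
  (forall l p t, 0 <= lm l p t) -> (forall l p t, 0 <= lp l p t) ->
  0 <= Psi_fin tau y prob x theta lm lp.
Proof.
move=> [q [q0 qsum qm qp]] lm0 lp0.
apply: (@le_trans _ _ (\sum_j \sum_p q j p * score tau lm lp j p)).
  rewrite sum_score; do 3![apply: sumr_ge0 => ? _].
  by rewrite addr_ge0 ?mulr_ge0.
apply: ler_sum => j _; rewrite -qsum mulr_suml.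
by apply: ler_sum => p _; rewrite ler_wpM2l ?le_max_ord.
Qed.

Lemma feasible_or_Psi_lt0 (R : realType) (T k J : nat) (tau : R)
    (y : 'I_J -> outcome R T) (prob : 'I_J -> R)
    (x : covpath R T k) (theta : param R k) :
  (0 < gridsize y x theta)%N -> (forall j, 0 <= prob j) ->
  primal_feasible tau y prob x theta \/
  exists lm lp : 'I_2 -> 'I_(gridsize y x theta) -> 'I_T -> R,
    [/\ forall l p t, 0 <= lm l p t, forall l p t, 0 <= lp l p t
      & Psi_fin tau y prob x theta lm lp < 0].
Proof.
move=> P_gt0 prob0.
pose K := ('I_(gridsize y x theta) * ('I_2 * 'I_T))%type.
pose B (j : 'I_J) (v : 'I_J * 'I_(gridsize y x theta)) : R := (v.1 == j)%:R.
(* The constraints at grid point [p] involve only the unknowns [q j p] with that [p], hence the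
   indicator. *)
pose A (c : K + K) (v : 'I_J * 'I_(gridsize y x theta)) : R := match c with
  | inl (p, (l, t)) => (v.2 == p)%:R * slack_minus tau v.1 l p t
  | inr (p, (l, t)) => (v.2 == p)%:R * slack_plus tau v.1 l p t end.
have [[q [q0 qB qA]]|[al [lam [lam0 dual al_gt0]]]] :=
    @farkas_mixed R _ _ _ B prob A.
- have Asum (f : 'I_J -> R) p :
      \sum_v (v.2 == p)%:R * f v.1 * q v = \sum_j q (j, p) * f j.
    rewrite sum_prod; apply: eq_bigr => j _ /=.
    under eq_bigr do rewrite -mulrA.
    by rewrite sum_delta mulrC.
  left; exists (fun j p => q (j, p)); split=> [//|j|l t p|l t p].
  + rewrite -qB sum_prod /B /=.
    under [RHS]eq_bigr do rewrite -mulr_sumr.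
    by rewrite sum_delta.
  + by rewrite -(Asum (fun j => slack_minus tau j l p t)); exact: (qA (inl (p, (l, t)))).
  + by rewrite -(Asum (fun j => slack_plus tau j l p t)); exact: (qA (inr (p, (l, t)))).
- pose lm l p t := lam (inl (p, (l, t))); pose lp l p t := lam (inr (p, (l, t))).
  right; exists lm, lp; split; [by move=> *; exact: lam0 | by move=> *; exact: lam0 | ].
  (* The dual inequality in column [(j, p)] reads [al j] plus the score at most zero: the indicators
     in [B] and [A] leave only the terms of [j] and [p]. *)
  have score_le j p : score tau lm lp j p <= - al j.
    rewrite -subr_le0 opprK addrC.
    apply: le_trans (dual (j, p)); rewrite le_eqVlt; apply/orP; left; apply/eqP.
    congr (_ + _).
      rewrite -(sum_delta R _ j al); apply: eq_bigr => i _.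
      by rewrite /B /= eq_sym mulrC.
    have Ksum (f : K -> R) (g : 'I_(gridsize y x theta) -> 'I_2 -> 'I_T -> R) :
        \sum_c f c * ((p == c.1)%:R * g c.1 c.2.1 c.2.2) =
        \sum_l \sum_t f (p, (l, t)) * g p l t.
      rewrite sum_prod -(sum_prod R _ _ (fun c => f (p, c) * g p c.1 c.2)).
      rewrite -(sum_delta R _ p (fun p' => \sum_c f (p', c) * g p' c.1 c.2)).
      apply: eq_bigr => p' _; rewrite mulr_sumr; apply: eq_bigr => c _ /=.
      by rewrite eq_sym mulrCA.
    rewrite big_sumType /= /score.
    under [LHS]eq_bigr do rewrite big_split /=.
    rewrite big_split /=; congr (_ + _).
      rewrite -(Ksum (lam \o inl) (fun p l t => slack_minus tau j l p t)).
      by apply: eq_bigr => -[p' [l t]] _.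
    rewrite -(Ksum (lam \o inr) (fun p l t => slack_plus tau j l p t)).
    by apply: eq_bigr => -[p' [l t]] _.
  (* Bounding each maximum by [- al j] and weighting by [prob j] gives minus the positive dual
     objective. *)
  apply: (@le_lt_trans _ _ (\sum_j - (al j * prob j))); last first.
    by rewrite sumrN oppr_lt0.
  apply: ler_sum => j _; rewrite mulrC -mulNr ler_wpM2r //.
  by apply: max_ord_le.
Qed.

Theorem corollary8p10 (R : realType) (T k : nat) (hT : (0 < T)%N) (hk : (0 < k)%N)
  (tau : R) (htau0 : 0 < tau) (htau1 : tau < 1) (htau2 : tau != 2^-1)
  (Pobs : probability (outcome R T * covpath R T k)%type R)
  (x : covpath R T k)
  (hx : (0 < Pobs [set yx | yx.2 = x])%E)
  (J : nat) (y : 'I_J -> outcome R T) (prob : 'I_J -> R)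
  (hcond : forall j, cond_prob Pobs [set yx | yx.1 = y j] [set yx | yx.2 = x] = prob j)
  (hpos : forall j, 0 < prob j)
  (hinj : injective y)
  (hsum : \sum_(j < J) prob j = 1)
  (theta : param R k) (hr : 0 < r theta) :
  (primal_feasible tau y prob x theta <->
     forall lm lp : 'I_2 -> 'I_(gridsize y x theta) -> 'I_T -> R,
       (forall l p t, 0 <= lm l p t) -> (forall l p t, 0 <= lp l p t) ->
       0 <= Psi_fin tau y prob x theta lm lp)
  /\
  (~ primal_feasible tau y prob x theta ->
     exists lm lp : 'I_2 -> 'I_(gridsize y x theta) -> 'I_T -> R,
       [/\ forall l p t, 0 <= lm l p t, forall l p t, 0 <= lp l p t
         & Psi_fin tau y prob x theta lm lp < 0]).
Proof.
(* Probabilities over an empty family would sum to 0 instead of 1; a nonempty family makes the grid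
   nonempty. *)
have J_gt0 : (0 < J)%N.
  case: J y prob hcond hpos hinj hsum => // ? ? _ _ _ /eqP.
  by rewrite big_ord0 eq_sym oner_eq0.
have dichotomy := @feasible_or_Psi_lt0 R T k J tau y prob x theta
  (gridsize_gt0 R T k J y x theta hT J_gt0) (fun j => ltW (hpos j)).
split; last by case: dichotomy.
split=> [feas lm lp lm0 lp0|Psi0]; first exact: feasible_Psi_ge0.
case: dichotomy => // -[lm [lp [lm0 lp0]]].
by rewrite ltNge Psi0.
Qed.
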